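(* Let $0<d<\infty$ and let $u:\mathbb{R}^2\to\mathbb{R}$ be a periodic function with domain of periodicity $P_0$ satisfying $D_3$-symmetry, where $$P_0=\left\{(x_1,x_2)\in\mathbb{R}^2:\ \tfrac{x_1}{\sqrt3}-\tfrac{2}{\sqrt3}d\le x_2\le \tfrac{x_1}{\sqrt3}+\tfrac{2}{\sqrt3}d,\ -d\le x_1\le d\right\}.$$ Let $\Delta_1,\Delta_2$ be the two equilateral triangular domains $$\Delta_1=\left\{(x_1,x_2)\in\mathbb{R}^2:\ -\tfrac{x_1}{\sqrt3}\le x_2\le \tfrac{x_1}{\sqrt3}+\tfrac{4}{\sqrt3}d,\ -2d\le x_1\le 2d\right\},$$ $$\Delta_2=\left\{(x_1,x_2)\in\mathbb{R}^2:\ \tfrac{x_1}{\sqrt3}-\tfrac{4}{\sqrt3}d\le x_2\le -\tfrac{x_1}{\sqrt3},\ -2d\le x_1\le 2d\right\}.$$ Then, for $k=1,2$, the restriction $u|_{\Delta_k}$ is $D_3$-symmetric about the centroid of $\Delta_k$, and the periodic pattern of $u$ can be generated by translations of $\Delta_1$ and $\Delta_2$; that is, there is a lattice $\Lambda\subset\mathbb{R}^2$ of periods of $u$ (so $u(x+\lambda)=u(x)$ for all $x\in\mathbb{R}^2$, $\lambda\in\Lambda$) such that the translates $\Delta_k+\lambda$ ($k\in\{1,2\}$, $\lambda\in\Lambda$) cover $\mathbb{R}^2$ and have pairwise disjoint interiors.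
   Context: Let $\mathcal{L}=\begin{bmatrix}1&-\tfrac12\\0&\tfrac{\sqrt3}{2}\end{bmatrix}$ and let $\mathcal{L}^{-T}$ be the inverse of its transpose; then $P_0$ is the (closed) parallelogram $\mathcal{L}^{-T}[-d,d]^2$. A function $u:\mathbb{R}^2\to\mathbb{R}$ is periodic with domain of periodicity $P_0$ if $u(x+p)=u(x)$ for all $x\in\mathbb{R}^2$ and all $p\in 2d\,\mathcal{L}^{-T}\mathbb{Z}^2$, i.e. $u$ is invariant under translation by $(2d,\tfrac{2d}{\sqrt3})$ and by $(0,\tfrac{4d}{\sqrt3})$. $D_3$ denotes the dihedral group of order $6$, acting linearly on $\mathbb{R}^2$ as the group of orthogonal matrices generated by the rotation $R_{2\pi/3}$ about the origin by angle $2\pi/3$ and the reflection $\begin{bmatrix}1&0\\0&-1\end{bmatrix}$. The function $u$ satisfies $D_3$-symmetry if $u(gx)=u(x)$ for all $g\in D_3$ and $x\in\mathbb{R}^2$. For a set $\Delta\subset\mathbb{R}^2$ and a point $c\in\mathbb{R}^2$, $u|_\Delta$ is $D_3$-symmetric about $c$ if for every $g\in D_3$ the map $x\mapsto g(x-c)+c$ maps $\Delta$ onto itself and $u(g(x-c)+c)=u(x)$ for all $x\in\Delta$. *)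

(* Defs.v *)
From HB Require Import structures.
From mathcomp Require Import all_boot all_order all_algebra.
From mathcomp Require Import all_classical all_reals all_analysis.
From mathcomp Require Import ring lra.
Import Order.TTheory GRing.Theory Num.Theory.
Import numFieldNormedType.Exports.

Set Implicit Arguments.
Unset Strict Implicit.
Unset Printing Implicit Defensive.

Local Open Scope classical_set_scope.
Local Open Scope ring_scope.

Section Plane.
Context {R : realType}.
Implicit Types (u : 'cV[R]_2 -> R) (D L : set 'cV[R]_2) (x c : 'cV[R]_2).
Implicit Types (d : R).

Definition x1 x : R := x 0 0.
Definition x2 x : R := x 1 0.

Definition mx22 (a b c d : R) : 'M[R]_2 :=
  \matrix_(i, j) if i == 0 then (if j == 0 then a else b)
                 else (if j == 0 then c else d).

(** Periodicity *)

Definition calL : 'M[R]_2 := mx22 1 (- (1 / 2)) 0 (Num.sqrt 3 / 2).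

Definition calLVT : 'M[R]_2 := invmx calL^T.

Definition lattice (B : 'M[R]_2) : set 'cV[R]_2 :=
  [set B *m map_mx intr z | z in [set: 'cV[int]_2]].

Definition is_lattice L := exists2 B, B \in unitmx & L = lattice B.

Definition invariant_under L u := forall x p, L p -> u (x + p) = u x.

Definition P0 d : set 'cV[R]_2 :=
  [set x | x1 x / Num.sqrt 3 - 2 / Num.sqrt 3 * d <= x2 x
             <= x1 x / Num.sqrt 3 + 2 / Num.sqrt 3 * d
           /\ - d <= x1 x <= d].

(* [P0 d] is the image of the square [-d, d]^2 under [calLVT] (lemma [P0E]);
   its translates by the lattice below tile the plane. *)
Definition periodic_with_domain_P0 d u :=
  invariant_under (lattice ((2 * d) *: calLVT)) u.

(** Symmetry *)

Definition rotation (t : R) : 'M[R]_2 := mx22 (cos t) (- sin t) (sin t) (cos t).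

Definition reflection : 'M[R]_2 := mx22 1 0 0 (-1).

Definition is_matrix_group n (G : set 'M[R]_n) :=
  [/\ G `<=` [set` unitmx], G 1%:M,
      forall g h, G g -> G h -> G (g *m h) & forall g, G g -> G (invmx g)].

Definition D3 : set 'M[R]_2 :=
  smallest (@is_matrix_group 2) [set rotation (2 * pi / 3); reflection].

Definition D3_symmetric u := forall g x, D3 g -> u (g *m x) = u x.

(* Only the values of [u] on [D] matter. *)
Definition D3_symmetric_about u D c := forall g, D3 g ->
  [set g *m (x - c) + c | x in D] = D /\
  forall x, D x -> u (g *m (x - c) + c) = u x.

(** Triangles *)

Definition Delta1 d : set 'cV[R]_2 :=
  [set x | - (x1 x / Num.sqrt 3) <= x2 x
             <= x1 x / Num.sqrt 3 + 4 / Num.sqrt 3 * d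
           /\ - (2 * d) <= x1 x <= 2 * d].

Definition Delta2 d : set 'cV[R]_2 :=
  [set x | x1 x / Num.sqrt 3 - 4 / Num.sqrt 3 * d <= x2 x
             <= - (x1 x / Num.sqrt 3)
           /\ - (2 * d) <= x1 x <= 2 * d].

Definition Delta d (k : 'I_2) := if k == 0 then Delta1 d else Delta2 d.

Definition triangle (a b c : 'cV[R]_2) : set 'cV[R]_2 :=
  [set x | exists r s t : R, [/\ 0 <= r, 0 <= s, 0 <= t, r + s + t = 1 &
                                 x = r *: a + s *: b + t *: c]].

(* The vertices of a nondegenerate triangle are its extreme points, so a set
   has at most one centroid in this sense. *)
Definition is_centroid D (m : 'cV[R]_2) := exists a b c : 'cV[R]_2,
  [/\ D = triangle a b c, row_mx (b - a) (c - a) \in unitmx &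
      m = 3^-1 *: (a + b + c)].

Definition translate D p : set 'cV[R]_2 := [set x + p | x in D].

Lemma calLVTE :
  calLVT = mx22 1 0 (1 / Num.sqrt 3) (2 / Num.sqrt 3).
Proof.
have s0 : Num.sqrt 3 != 0 :> R by rewrite sqrtr_eq0 -ltNge ltr0n.
have LT : calL^T *m mx22 1 0 (1 / Num.sqrt 3) (2 / Num.sqrt 3) = 1%:M.
  apply/matrixP => i j; rewrite !mxE !big_ord_recl big_ord0 !mxE.
  case: i => [[|[|i]] Hi] //; case: j => [[|[|j]] Hj] //=; by field.
have [LU _] := mulmx1_unit LT.
by rewrite /calLVT -[RHS](mulKmx LU) LT mulmx1.
Qed.

Lemma P0E d :
  P0 d = [set calLVT *m y |
    y in [set y : 'cV[R]_2 | forall i, - d <= y i 0 <= d]].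
Proof.
have s0 : 0 < Num.sqrt 3 :> R by rewrite sqrtr_gt0 ltr0n.
have sn0 : Num.sqrt 3 != 0 :> R by rewrite gt_eqF.
have E1 (y : 'cV[R]_2) : x1 (calLVT *m y) = y 0 0.
  by rewrite calLVTE /x1 !mxE !big_ord_recl big_ord0 !mxE /=; ring.
have E2 (y : 'cV[R]_2) :
    x2 (calLVT *m y) = y 0 0 / Num.sqrt 3 + y 1 0 * (2 / Num.sqrt 3).
  rewrite calLVTE /x2 !mxE !big_ord_recl big_ord0 !mxE /=.
  rewrite (_ : lift ord0 ord0 = 1); last exact/val_inj.
  by field.
have c0 : 0 < 2 / Num.sqrt 3 :> R by rewrite divr_gt0.
have key (y : 'cV[R]_2) :
    P0 d (calLVT *m y) <-> forall i, - d <= y i 0 <= d.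
  rewrite /P0 /= E1 E2 lerD2l lerD2l -mulrN ![2 / _ * _]mulrC.
  rewrite !(ler_pM2r c0); split=> [[H1 H0] [[|[|i]] Hi]|H] //.
  - by rewrite (_ : Ordinal Hi = 0) //; exact/val_inj.
  - by rewrite (_ : Ordinal Hi = 1) //; exact/val_inj.
have U : calLVT \in unitmx.
  have LT : calLVT *m mx22 1 0 (- (1 / 2)) (Num.sqrt 3 / 2) = 1%:M.
    rewrite calLVTE.
    apply/matrixP => i j; rewrite !mxE !big_ord_recl big_ord0 !mxE.
    by case: i => [[|[|i]] Hi] //; case: j => [[|[|j]] Hj] //=; field.
  by have [] := mulmx1_unit LT.
apply/seteqP; split=> [x Px|_ [y Hy <-]]; last exact/key/Hy.
by exists (invmx calLVT *m x); [apply/key|]; rewrite mulKVmx.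
Qed.

End Plane.

(* Main.v *)
Require Import Defs.
From HB Require Import structures.
From mathcomp Require Import all_boot all_order all_algebra.
From mathcomp Require Import all_classical all_reals all_analysis.
From mathcomp Require Import zify ring lra.
Import Order.TTheory GRing.Theory Num.Theory.
Import numFieldNormedType.Exports.

Local Open Scope classical_set_scope.
Local Open Scope ring_scope.

(** In the coordinates [(a, b)] of the basis formed by the columns of [calLVT],
    the periods are [2 d Z^2] and the two triangles are
    [{a <= 2d, b <= 2d, a + b >= 0}] and its opposite, i.e. the two halves of
    the square [[-2d, 2d]^2] cut along a diagonal; hence the translates by
    [4 d Z^2] tile the plane.  The centroids are [c = (2d/3, 2d/3)] and [-c],
    and for the generators [g] of [D3] the vector [c - g c] is a period, so that
    [x |-> g (x - c) + c = g x + (c - g c)] preserves [u]; these maps permute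
    the sides of each triangle. *)

(** * Exact trigonometric values and the determinant of order two *)

Lemma cos_pi_div3 (R : realType) : cos (pi / 3) = 1 / 2 :> R.
Proof.
have c0 : 0 < cos (pi / 3) :> R.
  by apply: cos_gt0_pihalf; have := pi_gt0 R; lra.
have E : cos (pi / 3 + (pi / 3 + pi / 3)) = -1 :> R.
  by rewrite -cospi; congr cos; field.
(* With [c = cos (pi / 3)], the triple-angle formula turns [cos pi = -1] into [4 c^3 - 3 c + 1 = 0],
   which factors as stated; positivity of [c] then excludes the root [-1]. *)
have {E} : (cos (pi / 3) + 1) * (2 * cos (pi / 3) - 1) ^+ 2 = 0 :> R.
  move: E; rewrite !(cosD, sinD); have := cos2Dsin2 (pi / 3 : R).
  move: (cos _) (sin _) => c s e E.
  transitivity ((c * (c * c - s * s) - s * (s * c + c * s) + 1)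
                + 3 * c * (c ^+ 2 + s ^+ 2 - 1)); first by ring.
  by rewrite E e; ring.
move/eqP; rewrite mulf_eq0 gt_eqF /=; last by lra.
by rewrite sqrf_eq0 subr_eq0 => /eqP; lra.
Qed.

(** Obtained by doubling the angle [pi / 3], whose sine is the positive square root of [1 - 1/4]. *)
Lemma rotation_2pi3 (R : realType) :
  rotation (2 * pi / 3) = mx22 (- (1 / 2)) (- (Num.sqrt 3 / 2))
                               (Num.sqrt 3 / 2) (- (1 / 2)) :> 'M[R]_2.
Proof.
have c3 := cos_pi_div3 R.
have s3 : sin (pi / 3) = Num.sqrt 3 / 2 :> R.
  have s0 : 0 < sin (pi / 3) :> R.
    by apply: sin_gt0_pi; have := pi_gt0 R; lra.
  apply/eqP; rewrite -(eqrXn2 (ltn0Sn 1)) ?ltW // ?divr_ge0 //.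
  rewrite exprMn sqr_sqrtr //; have := cos2Dsin2 (pi / 3 : R).
  by rewrite c3 => e; apply/eqP; lra.
rewrite /rotation (_ : 2 * pi / 3 = pi / 3 + pi / 3); last by field.
have s2 : Num.sqrt 3 * Num.sqrt 3 = 3 :> R by rewrite -expr2 sqr_sqrtr.
rewrite cosD sinD c3 s3.
by congr mx22; move: s2; move: (Num.sqrt 3) => s; lra.
Qed.

Lemma det_2x2 (R : comNzRingType) (A : 'M[R]_2) :
  \det A = A 0 0 * A 1 1 - A 0 1 * A 1 0.
Proof.
rewrite (expand_det_row _ 0) !big_ord_recl big_ord0 addr0 /cofactor.
rewrite !det_mx11 !mxE /=.
rewrite expr0 expr1 mul1r mulN1r mulrN.
by congr (_ * A _ _ - A _ _ * A _ _); exact/val_inj.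
Qed.

(** * Coordinates in the basis of the columns of [calLVT] *)

Section Oblique.
Context {R : realType}.
Implicit Types (x y c : 'cV[R]_2) (d r a b : R).

Lemma mx22_mulE (a b c d : R) x :
  (x1 (mx22 a b c d *m x) = a * x1 x + b * x2 x) *
  (x2 (mx22 a b c d *m x) = c * x1 x + d * x2 x).
Proof.
rewrite /x1 /x2 !mxE !big_ord_recl !big_ord0 !mxE /= !addr0.
by rewrite (_ : lift ord0 ord0 = 1) //; exact/val_inj.
Qed.

(* [(x1 x, y2 x)] are the entries of [calL^T *m x]. *)
Definition y2 x : R := (Num.sqrt 3 * x2 x - x1 x) / 2.

(** This is [calLVT] applied to the column [(a, b)], hence the inverse of the coordinate map
    [(x1, y2)]. *)
Definition oblique a b : 'cV[R]_2 :=
  \col_i if i == 0 then a else (a + 2 * b) / Num.sqrt 3.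

Lemma sqrt3_gt0 : 0 < Num.sqrt 3 :> R.
Proof. by rewrite sqrtr_gt0. Qed.

Lemma sqrt3_neq0 : Num.sqrt 3 != 0 :> R.
Proof. by rewrite gt_eqF ?sqrt3_gt0. Qed.

Lemma x2E x : x2 x = (x1 x + 2 * y2 x) / Num.sqrt 3.
Proof. by rewrite /y2; field; exact: sqrt3_neq0. Qed.

Lemma obliqueE a b : (x1 (oblique a b) = a) * (y2 (oblique a b) = b).
Proof.
rewrite /y2 /x1 /x2 !mxE /=; split=> //; field; exact: sqrt3_neq0.
Qed.

Lemma oblique_ext x y : x1 x = x1 y -> y2 x = y2 y -> x = y.
Proof.
move=> e1 e2; have e3 : x2 x = x2 y by rewrite !x2E e1 e2.
apply/colP => -[[|[|i]] Hi] //.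
- by move: e1; rewrite /x1 (_ : 0 = Ordinal Hi) //; exact/val_inj.
- by move: e3; rewrite /x2 (_ : 1 = Ordinal Hi) //; exact/val_inj.
Qed.

Lemma x1D x y : x1 (x + y) = x1 x + x1 y. Proof. by rewrite /x1 mxE. Qed.
Lemma x1N x : x1 (- x) = - x1 x. Proof. by rewrite /x1 mxE. Qed.
Lemma x1Z r x : x1 (r *: x) = r * x1 x. Proof. by rewrite /x1 mxE. Qed.
Lemma y2D x y : y2 (x + y) = y2 x + y2 y.
Proof. by rewrite /y2 /x1 /x2 !mxE; ring. Qed.
Lemma y2N x : y2 (- x) = - y2 x.
Proof. by rewrite /y2 /x1 /x2 !mxE; ring. Qed.
Lemma y2Z r x : y2 (r *: x) = r * y2 x.
Proof. by rewrite /y2 /x1 /x2 !mxE; ring. Qed.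

Definition obliqueDE := (x1D, x1N, x1Z, y2D, y2N, y2Z, obliqueE).

(** In oblique coordinates the generators of [D3] have integer matrices: the square roots disappear,
    and later inequalities are left to [lra]. *)
Lemma rotation_oblique x :
  (x1 (rotation (2 * pi / 3) *m x) = - x1 x - y2 x) *
  (y2 (rotation (2 * pi / 3) *m x) = x1 x).
Proof.
have s2 : Num.sqrt 3 * Num.sqrt 3 = 3 :> R by rewrite -expr2 sqr_sqrtr.
rewrite /y2 rotation_2pi3 !mx22_mulE; split; first by field.
transitivity ((Num.sqrt 3 * Num.sqrt 3 * x1 x + x1 x) / 4); first by field.
by rewrite s2; field.
Qed.

Lemma reflection_oblique x :
  (x1 (reflection *m x) = x1 x) * (y2 (reflection *m x) = - x1 x - y2 x).
Proof. by rewrite /y2 /reflection !mx22_mulE; split; field. Qed.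

Lemma calLVT_oblique x :
  (x1 (calLVT *m x) = x 0 0) * (y2 (calLVT *m x) = x 1 0).
Proof.
by rewrite /y2 calLVTE !mx22_mulE /x1 /x2; split; field; rewrite // sqrt3_neq0.
Qed.

Lemma latticeP r x : lattice (r *: calLVT) x <->
  exists m n : int, x1 x = r * m%:~R /\ y2 x = r * n%:~R.
Proof.
split=> [[z _ <-]|[m [n [e1 e2]]]].
  exists (z 0 0), (z 1 0).
  by rewrite -scalemxAl !obliqueDE !calLVT_oblique !mxE.
exists (\col_i if i == 0 then m else n) => //.
by apply: oblique_ext; rewrite -scalemxAl !obliqueDE !calLVT_oblique !mxE.
Qed.

Lemma calLVT_unit : (calLVT : 'M[R]_2) \in unitmx.
Proof.
rewrite unitmx_inv unitmx_tr unitmxE unitfE det_2x2 !mxE /=.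
by have := sqrt3_gt0; rewrite (gt_eqF, mulr0) ?subr0 //; nra.
Qed.

Lemma scale_calLVT_lattice r : r != 0 -> is_lattice (lattice (r *: calLVT)).
Proof.
move=> r0; exists (r *: calLVT) => //.
by rewrite unitmxZ ?calLVT_unit ?unitfE.
Qed.

(** * The triangles: inequalities, interiors, centroids *)

Lemma interior_ray (D : set 'cV[R]_2) x v :
  interior D x -> exists2 t : R, 0 < t & D (x + t *: v).
Proof.
move=> Dx.
have cv : x + t *: v @[t --> (0 : R)^'+] --> x.
  apply: cvg_at_right_filter; rewrite -[X in _ --> X]addr0 -(scale0r v).
  by apply: cvgD; [exact: cvg_cst|apply: cvgZr_tmp; exact: cvg_id].
have near_t : \forall t \near (0 : R)^'+, 0 < t /\ D (x + t *: v).
  by apply: filterI; [exact: nbhs_right_gt|exact: cv].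
by have [t [t0 Dt]] := filter_ex near_t; exists t.
Qed.

(** Since [Delta2] is the opposite of [Delta1], the sign [(-1) ^+ k] treats both at once. In the
    converse direction, the missing bound on [x1] comes from chaining the last two inequalities. *)
Lemma DeltaP d (k : 'I_2) x : 0 < d -> Delta d k x <->
  [/\ (-1) ^+ k * x1 x <= 2 * d, (-1) ^+ k * y2 x <= 2 * d
    & 0 <= (-1) ^+ k * (x1 x + y2 x)].
Proof.
move=> d0; have i0 : 0 < (Num.sqrt 3)^-1 :> R by rewrite invr_gt0 sqrt3_gt0.
rewrite /Delta; case: k => [[|[|k]] Hk] //=; rewrite ?expr0 ?expr1.
- rewrite /Delta1 /= x2E -mulNr [4 / _ * _]mulrAC -mulrDl !(ler_pM2r i0).
  by split=> [[/andP[? ?] /andP[? ?]]|[? ? ?]]; split; lra.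
- rewrite /Delta2 /= x2E [4 / _ * _]mulrAC -mulrBl -[- (x1 x / _)]mulNr.
  rewrite !(ler_pM2r i0).
  by split=> [[/andP[? ?] /andP[? ?]]|[? ? ?]]; split; lra.
Qed.

Lemma translateP (D : set 'cV[R]_2) p x : translate D p x <-> D (x - p).
Proof.
split=> [[y Dy <-]|Dx]; first by rewrite addrK.
by exists (x - p) => //; rewrite subrK.
Qed.

(** The first two conditions describe an open square independent of [k], which will determine the
    lattice vector; the third tells the two halves apart and will determine [k]. *)
Lemma interior_Delta d (k : 'I_2) p x : 0 < d ->
  interior (translate (Delta d k) p) x ->
  [/\ - (2 * d) < x1 (x - p) < 2 * d, - (2 * d) < y2 (x - p) < 2 * d
    & 0 < (-1) ^+ k * (x1 (x - p) + y2 (x - p))].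
Proof.
move=> d0 Ix; set s : R := (-1) ^+ k.
(* Each direction points towards one side of the triangle. As a small move along it stays inside,
   the inequality of that side is strict. *)
have [t1 t10] := interior_ray _ _ (oblique s 0) Ix.
have [t2 t20] := interior_ray _ _ (oblique 0 s) Ix.
have [t3 t30] := interior_ray _ _ (oblique (- s) 0) Ix.
rewrite !translateP !DeltaP // !obliqueDE => -[_ _ h3] [_ h2 _] [h1 _ _].
move: h1 h2 h3; rewrite /s; case: (k) => [[|[|//]] Hk] /=;
  rewrite ?expr0 ?expr1 => h1 h2 h3; split; try (apply/andP; split); lra.
Qed.

Lemma det_row_mx (v w : 'cV[R]_2) :
  \det (row_mx v w) = x1 v * x2 w - x1 w * x2 v.
Proof.
have El i : row_mx v w i 0 = v i 0.
  by rewrite -(row_mxEl v w i 0); congr (row_mx _ _ _ _); exact/val_inj.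
have Er i : row_mx v w i 1 = w i 0.
  by rewrite -(row_mxEr v w i 0); congr (row_mx _ _ _ _); exact/val_inj.
by rewrite det_2x2 !El !Er.
Qed.

Definition Delta_center d (k : 'I_2) : 'cV[R]_2 :=
  oblique ((-1) ^+ k * (2 * d / 3)) ((-1) ^+ k * (2 * d / 3)).

Lemma Delta_center_centroid d (k : 'I_2) : 0 < d ->
  is_centroid (Delta d k) (Delta_center d k).
Proof.
move=> d0; set s : R := (-1) ^+ k.
have ss : s * s = 1 by rewrite -expr2 sqrr_sign.
have dn0 : d != 0 by rewrite gt_eqF.
(* Up to the sign [s], the vertices are the two ends of the cutting diagonal and the corner of the
   square beyond it. *)
exists (s *: oblique (- (2 * d)) (2 * d)), (s *: oblique (2 * d) (- (2 * d))),
  (s *: oblique (2 * d) (2 * d)); split.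
- apply/seteqP; split=> x; rewrite DeltaP // -/s.
  (* Barycentric coordinates: each is affine, vanishes on one side and equals 1 at the opposite
     vertex. *)
  + move=> [h1 h2 h3]; exists ((2 * d - s * x1 x) / (4 * d)),
      ((2 * d - s * y2 x) / (4 * d)), (s * (x1 x + y2 x) / (4 * d)).
    have d4 : 0 <= 4 * d by lra.
    split; [by rewrite divr_ge0 // subr_ge0|by rewrite divr_ge0 // subr_ge0
      |by rewrite divr_ge0|by field|].
    apply: oblique_ext; rewrite !obliqueDE.
      by transitivity (s * s * x1 x); [rewrite ss mul1r|field].
    by transitivity (s * s * y2 x); [rewrite ss mul1r|field].
  + move=> [r [t [w [r0 t0 w0 e ->]]]]; rewrite !obliqueDE.
    have -> : w = 1 - r - t by lra.
    split.
    * rewrite [leLHS](_ : _ = s * s * (2 * d * (1 - 2 * r))); last by ring.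
      by rewrite ss; nra.
    * rewrite [leLHS](_ : _ = s * s * (2 * d * (1 - 2 * t))); last by ring.
      by rewrite ss; nra.
    * rewrite [leRHS](_ : _ = s * s * (4 * d * (1 - r - t))); last by ring.
      by rewrite ss; nra.
- rewrite unitmxE unitfE det_row_mx !x2E !obliqueDE.
  (* The edge vectors have determinant [16 d^2] in oblique coordinates, and [calLVT] has determinant
     [2 / sqrt 3]. *)
  rewrite [X in X != 0](_ : _ = s * s * (32 * d ^+ 2 / Num.sqrt 3)); last first.
    by field; exact: sqrt3_neq0.
  by rewrite ss mul1r mulf_neq0 ?invr_neq0 ?sqrt3_neq0 // mulf_neq0 ?expf_neq0.
- by apply: oblique_ext; rewrite !obliqueDE -/s; field.
Qed.

(** * The group [D3] and symmetry about a point *)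

Lemma smallest_D3 (G : set 'M[R]_2) : is_matrix_group G ->
  G (rotation (2 * pi / 3)) -> G reflection -> D3 `<=` G.
Proof.
by move=> mG Gr Gs; apply: smallest_sub => // g [->|->].
Qed.

Lemma D3_rotation : D3 (rotation (2 * pi / 3) : 'M[R]_2).
Proof. by move=> G [_]; apply; left. Qed.

Lemma D3_reflection : D3 (reflection : 'M[R]_2).
Proof. by move=> G [_]; apply; right. Qed.

Lemma rotation_unit r : (rotation r : 'M[R]_2) \in unitmx.
Proof.
rewrite unitmxE unitfE det_2x2 !mxE /= mulNr opprK -!expr2 cos2Dsin2.
exact: oner_neq0.
Qed.

Lemma reflection_unit : (reflection : 'M[R]_2) \in unitmx.
Proof. by rewrite unitmxE unitfE det_2x2 !mxE /=; apply/eqP; lra. Qed.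

(** The invertible [g] whose affine map about [c] preserves [D] and [u] form a matrix group, so it
    contains [D3] as soon as it contains the generators. Stating invariance of [D] as an equivalence
    makes the condition stable under inverses. *)
Lemma D3_symmetric_about_gen (u : 'cV[R]_2 -> R) (D : set 'cV[R]_2) c :
  (forall g, g = rotation (2 * pi / 3) \/ g = reflection ->
     (forall x, D (g *m (x - c) + c) <-> D x) /\
     (forall x, u (g *m (x - c) + c) = u x)) ->
  D3_symmetric_about u D c.
Proof.
move=> gen.
pose G := [set g : 'M[R]_2 | [/\ g \in unitmx,
  (forall x, D (g *m (x - c) + c) <-> D x)
  & forall x, u (g *m (x - c) + c) = u x]].
have mulE (g h : 'M[R]_2) x :
    g *m h *m (x - c) + c = g *m ((h *m (x - c) + c) - c) + c.
  by rewrite addrK mulmxA.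
have mulK g (x : 'cV[R]_2) : g \in unitmx ->
    g *m ((invmx g *m (x - c) + c) - c) + c = x.
  by move=> gU; rewrite addrK mulKVmx // subrK.
have mG : is_matrix_group G.
  split.
  - by move=> g [].
  - by split=> [|x|x]; rewrite ?unitmx1 // mul1mx subrK.
  - move=> g h [gU gD gu] [hU hD hu]; split; first by rewrite unitmx_mul gU.
    + by move=> x; rewrite mulE gD hD.
    + by move=> x; rewrite mulE gu hu.
  - move=> g [gU gD gu]; split; first by rewrite unitmx_inv.
    + by move=> x; rewrite -(gD (_ + c)) mulK.
    + by move=> x; rewrite -(gu (_ + c)) mulK.
have sub : D3 `<=` G.
  apply: smallest_D3 => //.
  - by have [|? ?] := gen (rotation (2 * pi / 3));
      [left|split=> //; exact: rotation_unit].
  - by have [|? ?] := gen reflection;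
      [right|split=> //; exact: reflection_unit].
move=> g /sub[gU gD gu]; split=> [|x _]; last exact: gu.
apply/seteqP; split=> [_ [x Dx <-]|x Dx]; first exact/gD.
by exists (invmx g *m (x - c) + c); [apply/gD|]; rewrite mulK.
Qed.

Lemma Delta_symmetric d (u : 'cV[R]_2 -> R) (k : 'I_2) : 0 < d ->
  periodic_with_domain_P0 d u -> D3_symmetric u ->
  D3_symmetric_about u (Delta d k) (Delta_center d k).
Proof.
move=> d0 uP uS; set c := Delta_center d k; set s : R := (-1) ^+ k.
have moveE (g : 'M[R]_2) x : g *m (x - c) + c = g *m x + (c - g *m c).
  by rewrite mulmxBr -!addrA; congr (_ + _); rewrite addrC.
have uE (g : 'M[R]_2) : D3 g -> lattice ((2 * d) *: calLVT) (c - g *m c) ->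
    forall x, u (g *m (x - c) + c) = u x.
  by move=> Dg Lg x; rewrite moveE uP // uS.
apply: D3_symmetric_about_gen => g [->|->]; split.
- move=> x; rewrite !DeltaP // !obliqueDE !rotation_oblique !obliqueDE.
  case: (k) => [[|[|//]] Hk] /=; rewrite ?expr0 ?expr1.
    by split=> -[? ? ?]; split; lra.
  by split=> -[? ? ?]; split; lra.
- apply: uE; first exact: D3_rotation.
  (* With [c = s (2d/3, 2d/3)], the rotation gives [g c = s (-4d/3, 2d/3)], so
     [c - g c = 2d (s, 0)]. *)
  apply/latticeP; exists ((-1) ^+ k), 0.
  rewrite !obliqueDE !rotation_oblique !obliqueDE rmorphXn /= rmorphN1.
  by split; field.
- move=> x; rewrite !DeltaP // !obliqueDE !reflection_oblique !obliqueDE.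
  case: (k) => [[|[|//]] Hk] /=; rewrite ?expr0 ?expr1.
    by split=> -[? ? ?]; split; lra.
  by split=> -[? ? ?]; split; lra.
- apply: uE; first exact: D3_reflection.
  (* Here [g c = s (2d/3, -4d/3)], so [c - g c = 2d (0, s)]. *)
  apply/latticeP; exists 0, ((-1) ^+ k).
  rewrite !obliqueDE !reflection_oblique !obliqueDE rmorphXn /= rmorphN1.
  by split; field.
Qed.

(** * Tiling by the lattice of step [4 d] *)

Lemma Delta_cover d x : 0 < d -> exists (k : 'I_2) p,
  lattice ((4 * d) *: calLVT) p /\ Delta d k (x - p).
Proof.
move=> d0; have d4 : 0 < 4 * d by lra.
(* The shift by [2 * d] makes the floor round [a / (4 * d)] to a nearest integer, so the remainder
   lies in the centred interval. *)
pose m a : int := Num.floor ((a + 2 * d) / (4 * d)).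
have mP a : - (2 * d) <= a - 4 * d * (m a)%:~R <= 2 * d.
  have /andP[] := floor_itv ((a + 2 * d) / (4 * d)).
  rewrite -/(m a) intrD ler_pdivlMr // ltr_pdivrMr // => h1 h2.
  by apply/andP; split; lra.
pose p := oblique (4 * d * (m (x1 x))%:~R) (4 * d * (m (y2 x))%:~R).
have Lp : lattice ((4 * d) *: calLVT) p.
  by apply/latticeP; exists (m (x1 x)), (m (y2 x)); rewrite !obliqueDE.
have /andP[a1 a2] := mP (x1 x); have /andP[b1 b2] := mP (y2 x).
(* The sign of the coordinate sum tells on which side of the diagonal the reduced point lies. *)
have [s0|s0] := leP 0 (x1 (x - p) + y2 (x - p)).
  exists 0, p; split=> //; apply/DeltaP => //; move: s0.
  by rewrite !obliqueDE /= expr0 => s0; split; lra.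
exists 1, p; split=> //; apply/DeltaP => //; move: s0.
by rewrite !obliqueDE /= expr1 => s0; split; lra.
Qed.

(** Two multiples of [2 * r] at distance less than [r] from [a] differ by less than [2 * r], so
    their integer factors differ by less than 1. *)
Lemma int_multiple_eq r (m n : int) a : 0 < r ->
  - r < a - 2 * r * m%:~R < r -> - r < a - 2 * r * n%:~R < r -> m = n.
Proof.
move=> r0 /andP[h1 h2] /andP[h3 h4].
have h5 : (2 * r) * (m - n)%:~R < (2 * r) * 1%:~R by rewrite intrB; lra.
have h6 : (2 * r) * (n - m)%:~R < (2 * r) * 1%:~R by rewrite intrB; lra.
have r2 : 0 < 2 * r by lra.
by move: h5 h6; rewrite !(ltr_pM2l r2) !ltr_int; lia.
Qed.

End Oblique.

Theorem theorem2p2 (R : realType) (d : R) (u : 'cV[R]_2 -> R) :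
  0 < d ->
  periodic_with_domain_P0 d u ->
  D3_symmetric u ->
  (forall k : 'I_2,
     exists2 c, is_centroid (Delta d k) c & D3_symmetric_about u (Delta d k) c)
  /\
  exists L : set 'cV[R]_2,
    [/\ is_lattice L,
        invariant_under L u,
        \bigcup_(i in [set: 'I_2] `*` L) translate (Delta d i.1) i.2 = setT &
        trivIset ([set: 'I_2] `*` L)
          (fun i => interior (translate (Delta d i.1) i.2))].
Proof.
move=> d0 uP uS; split=> [k|].
  exists (Delta_center d k); first exact: Delta_center_centroid.
  exact: Delta_symmetric.
exists (lattice ((4 * d) *: calLVT)); split.
- by apply: scale_calLVT_lattice; rewrite gt_eqF // mulr_gt0.
(* The lattice of step [4 * d] is contained in the period lattice of step [2 * d]: the coefficients
   double. *)
- move=> x p /latticeP[m [n [e1 e2]]]; apply: uP; apply/latticeP.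
  by exists (2 * m), (2 * n); rewrite e1 e2 !intrM; split; ring.
- apply/seteqP; split=> // x _; have [k [p [Lp Dp]]] := Delta_cover d x d0.
  by exists (k, p) => //=; apply/translateP.
- move=> [k p] [l q] [/= _ /latticeP[m [n [p1 p2]]]].
  move=> [/= _ /latticeP[m' [n' [q1 q2]]]] [x [/= Ip Iq]].
  have [] := interior_Delta _ _ _ _ d0 Ip.
  have [] := interior_Delta _ _ _ _ d0 Iq.
  rewrite !obliqueDE p1 p2 q1 q2.
  (* The squares have half-width [2 * d], which is the [r] of [int_multiple_eq]. *)
  have -> : 4 * d = 2 * (2 * d) by ring.
  have d2 : 0 < 2 * d by lra.
  move=> aq bq sq ap bp.
  have em := int_multiple_eq _ _ _ _ d2 ap aq.
  have en := int_multiple_eq _ _ _ _ d2 bp bq.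
  have -> : p = q by apply: oblique_ext; rewrite ?p1 ?q1 ?p2 ?q2 ?em ?en.
  (* Both strict sign conditions now concern the same reduced point, so distinct [k] and [l] would
     contradict each other. *)
  move: sq; rewrite em en => sq sp; congr (_, _).
  move: sq sp; case: k l {Ip Iq} => [[|[|//]] Hk] [[|[|//]] Hl];
    rewrite /= ?expr0 ?expr1 => h1 h2; first [exact/val_inj | exfalso; lra].
Qed.
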